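(* Let $(S,\theta)$ be an ID-simple ring. If $(M,\theta_M)$ is an ID-module over $(S,\theta)$, then $M$ is a projective $S$-module.
   Context: All rings are commutative with unit and nonzero; rings are not assumed Noetherian. An iterative derivation on a ring $R$ is a ring homomorphism $\theta:R\to R[[T]]$, written $\theta(r)=\sum_{i\ge 0}\theta^{(i)}(r)T^i$, with $\theta^{(0)}=\mathrm{id}_R$ and $\theta^{(i)}\circ\theta^{(j)}=\binom{i+j}{i}\theta^{(i+j)}$ for all $i,j\ge 0$; then $(R,\theta)$ is an ID-ring. An ideal $I$ of $R$ is an ID-ideal if $\theta(I)\subseteq I[[T]]$; $R$ is ID-simple if its only ID-ideals are $\{0\}$ and $R$. An ID-module $(M,\theta_M)$ over an ID-ring $(R,\theta)$ is a finitely generated $R$-module $M$ with an additive map $\theta_M:M\to M[[T]]$, $\theta_M(m)=\sum_i\theta_M^{(i)}(m)T^i$, such that $\theta_M(rm)=\theta(r)\theta_M(m)$ for $r\in R$, $m\in M$, $\theta_M^{(0)}=\mathrm{id}_M$ and $\theta_M^{(i)}\circ\theta_M^{(j)}=\binom{i+j}{i}\theta_M^{(i+j)}$ for all $i,j\ge0$. *)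

(* Defs.v *)
From mathcomp Require Import all_boot all_algebra.
From mathcomp Require Import classical_sets.

Set Implicit Arguments.
Unset Strict Implicit.
Unset Printing Implicit Defensive.

Import GRing.Theory.
Local Open Scope ring_scope.
Local Open Scope classical_set_scope.

(* V[[T]]: a formal power series is the sequence of its coefficients, and
   equality of power series is stated coefficientwise.  A map
   theta : V -> V[[T]] has theta^(i)(v) = theta v i. *)
Definition pseries (V : Type) : Type := nat -> V.

Definition ps_one (R : nzRingType) : pseries R := fun k => (k == 0%N)%:R.

Definition ps_add (V : nmodType) (f g : pseries V) : pseries V :=
  fun k => f k + g k.

Definition ps_mul (R : nzRingType) (f g : pseries R) : pseries R :=
  fun k => \sum_(i < k.+1) f i * g (k - i)%N.

(* The R[[T]]-module structure of M[[T]]. *)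
Definition ps_scale (R : nzRingType) (M : lmodType R)
    (f : pseries R) (m : pseries M) : pseries M :=
  fun k => \sum_(i < k.+1) f i *: m (k - i)%N.

Definition iterative (V : nmodType) (theta : V -> pseries V) : Prop :=
  (forall v, theta v 0%N = v) /\
  (forall i j v, theta (theta v j) i = theta v (i + j)%N *+ 'C(i + j, i)).

Definition ps_ring_morphism (R : nzRingType) (theta : R -> pseries R) : Prop :=
  [/\ theta 1 =1 ps_one R,
      forall a b, theta (a + b) =1 ps_add (theta a) (theta b)
    & forall a b, theta (a * b) =1 ps_mul (theta a) (theta b)].

Definition iterative_derivation (R : comNzRingType) (theta : R -> pseries R) :
  Prop := ps_ring_morphism theta /\ iterative theta.

Definition is_ideal (R : comNzRingType) (I : set R) : Prop :=
  [/\ I 0, forall a b, I a -> I b -> I (a + b)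
    & forall r a, I a -> I (r * a)].

Definition ID_ideal (R : comNzRingType) (theta : R -> pseries R) (I : set R) :
  Prop := is_ideal I /\ (forall a, I a -> forall i, I (theta a i)).

Definition ID_simple (R : comNzRingType) (theta : R -> pseries R) : Prop :=
  forall I : set R, ID_ideal theta I -> I = [set 0] \/ I = setT.

Definition fin_generated (R : comNzRingType) (M : lmodType R) : Prop :=
  exists (n : nat) (e : 'I_n -> M),
    forall m : M, exists c : 'I_n -> R, m = \sum_(i < n) c i *: e i.

Definition ID_module (R : comNzRingType) (theta : R -> pseries R)
    (M : lmodType R) (thetaM : M -> pseries M) : Prop :=
  [/\ fin_generated M,
      forall m n, thetaM (m + n) =1 ps_add (thetaM m) (thetaM n),
      forall r m, thetaM (r *: m) =1 ps_scale (theta r) (thetaM m)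
    & iterative thetaM].

Definition projective (R : comNzRingType) (P : lmodType R) : Prop :=
  forall (M N : lmodType R) (g : {linear M -> N}) (f : {linear P -> N}),
    (forall y : N, exists x : M, g x = y) ->
    exists h : {linear P -> M}, forall p : P, g (h p) = f p.

(* Main.v *)
Require Import Defs.
From HB Require Import structures.
From mathcomp Require Import all_boot all_algebra.
From mathcomp Require Import boolp classical_sets.

(** Why an ID-module M over an ID-simple ring S is projective.

    Choose generators e_1, ..., e_n of M and let K be the module of relations,
    the kernel of the map v |-> sum v_i e_i from S^n onto M.  For every d let
    I_d be the ideal generated by the d x d minors of matrices with rows in K,
    that is, the Fitting ideal of M of index n - d; K need not be finitely
    generated, so infinitely many matrices may be involved.

    Each I_d is an ID-ideal ([minor_ideal_ID]).  Lift theta_M along S^n -> M: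
    if theta_M(e_i) = sum_j B_ij(T) e_j with B(0) = 1, then
    v |-> theta(v) B(T) maps K into K[[T]], and B(T) is invertible.  Hence
    theta(v w) = (theta(v) B) (B^-1 theta(w)) for a row v and a column w
    ([lift_theta]), so that theta of the determinant of A P, where A has rows
    in K, is the determinant of a product of the same shape over S[[T]].
    Expanding it by multilinearity, its coefficients lie in I_d.

    As S is ID-simple, every I_d is 0 or S.  Moreover I_0 = S, and I_(n+1) = 0
    because a square matrix of size n+1 that factors through S^n has
    determinant 0.  So there is d with I_d = S and I_(d+1) = 0.

    These two equations split S^n -> M without any localization.  For A with d
    rows in K and P of size n x d, border A P by the row v P and the l-th
    column of the matrix with rows v and A.  The determinants for l = 1..n
    form a vector phi(v), linear in v.  Laplace expansion along the bordering
    column shows that phi(v) is det(A P) v plus an element of K; and when v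
    lies in K, its entries lie in I_(d+1), so phi(v) = 0.  Linear combinations
    of such maps, with coefficients expressing 1 in I_d, give an endomorphism
    of S^n that kills K and is the identity modulo K: a section of S^n -> M. *)

Set Implicit Arguments.
Unset Strict Implicit.
Unset Printing Implicit Defensive.

Import GRing.Theory.
Local Open Scope ring_scope.
Local Open Scope classical_set_scope.

(** * Convolutions and determinants *)

Lemma additive_series0 (V : zmodType) (f : V -> pseries V) (m : nat) :
  (forall a b, f (a + b) =1 ps_add (f a) (f b)) -> f 0 m = 0.
Proof.
by move=> fD; apply: (@addrI _ (f 0 m)); rewrite -[LHS]fD !addr0.
Qed.

(** Associativity of convolution, for the coefficients of a triple product. *)
Lemma sum_triangle (V : nmodType) (m : nat) (F : nat -> nat -> nat -> V) :
  \sum_(c < m.+1) \sum_(a < c.+1) F a (c - a)%N (m - c)%N =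
  \sum_(a < m.+1) \sum_(b < (m - a).+1) F a b (m - a - b)%N.
Proof.
under eq_bigr => c _ do
  rewrite (big_ord_widen m.+1 (fun a => F a (c - a)%N (m - c)%N)) ?ltn_ord //.
rewrite (exchange_big_dep xpredT) //=; apply: eq_bigr => a _.
have le_am : (a <= m)%N by rewrite -ltnS.
rewrite -(big_mkord (fun c => (a < c.+1)%N) (fun c => F a (c - a)%N (m - c)%N)).
rewrite (@big_cat_nat _ _ _ a) ?(leqW le_am) //= [X in X + _]big_nat_cond.
rewrite big1 ?add0r => [|c /andP[/andP[_ lt_ca] le_ac]]; last first.
  by rewrite ltnS leqNgt lt_ca in le_ac.
rewrite -{1}[nat_of_ord a]add0n big_addn subSn //.
rewrite -(big_mkord xpredT (fun b => F a b (m - a - b)%N)).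
rewrite [LHS]big_nat_cond [RHS]big_nat_cond.
apply: eq_big => [b|b _]; first by rewrite !ltnS leq_addl.
by rewrite addnK addnC subnDA.
Qed.

(** A matrix power series B(T) with B(0) = 1 is invertible: the equation
    B(T) q(T) = t(T) determines the coefficients of q one after the other. *)
Lemma conv_solve (R : nzRingType) (n : nat) (B : nat -> 'M[R]_n)
    (t : nat -> 'cV[R]_n) :
  B 0%N = 1%:M ->
  exists q : nat -> 'cV[R]_n,
    forall m, t m = \sum_(a < m.+1) B a *m q (m - a)%N.
Proof.
move=> B0.
(* [next s] is the coefficient of q that follows those listed in [s]. *)
pose next s := let m := size s in
  t m - \sum_(a < m) B a.+1 *m nth 0 s (m - a.+1)%N.
pose prefix := fix prefix m :=
  if m is k.+1 then rcons (prefix k) (next (prefix k)) else [::].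
have size_prefix m : size (prefix m) = m.
  by elim: m => //= m IHm; rewrite size_rcons IHm.
have nth_prefix m k : (k < m)%N -> nth 0 (prefix m) k = next (prefix k).
  elim: m => // m IHm; rewrite ltnS leq_eqVlt => /predU1P[->|lt_km] /=.
    by rewrite nth_rcons size_prefix ltnn eqxx.
  by rewrite nth_rcons size_prefix lt_km IHm.
exists (fun m => next (prefix m)) => m.
rewrite big_ord_recl subn0 B0 mul1mx {1}/next size_prefix /=.
rewrite addrAC -addrA -sumrB big1 ?addr0 // => a _.
by rewrite nth_prefix ?subrr // ltn_subrL; case: m a => // -[].
Qed.

(** The determinant is multilinear in the rows, row i being the combination
    of the rows F i a with coefficients x a. *)
Lemma det_sum_rows (R : comNzRingType) (d N : nat) (x : 'I_N -> R)
    (F : 'I_d -> 'I_N -> 'I_d -> R) :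
  \det (\matrix_(i, j) \sum_a x a * F i a j) =
  \sum_(u : {ffun 'I_d -> 'I_N})
    (\prod_i x (u i)) * \det (\matrix_(i, j) F i (u i) j).
Proof.
rewrite /determinant.
under eq_bigr => s _.
  under eq_bigr => i _ do rewrite mxE.
  rewrite bigA_distr_bigA mulr_sumr; over.
rewrite exchange_big /=; apply: eq_bigr => u _.
rewrite mulr_sumr; apply: eq_bigr => s _.
rewrite big_split mulrCA /=; congr (_ * (_ * _)).
by apply: eq_bigr => i _; rewrite mxE.
Qed.

(** Determinants respect every relation between two rings that respects the
    ring operations.  It serves to compare x with the polynomials truncating
    theta(x): these depend multiplicatively on x only up to higher order. *)
Lemma det_related (R1 R2 : comNzRingType) (rel : R1 -> R2 -> Prop) (d : nat)
    (A1 : 'M[R1]_d) (A2 : 'M[R2]_d) :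
    rel 0 0 -> rel 1 1 -> (forall x y, rel x y -> rel (- x) (- y)) ->
    (forall x1 x2 y1 y2, rel x1 x2 -> rel y1 y2 -> rel (x1 + y1) (x2 + y2)) ->
    (forall x1 x2 y1 y2, rel x1 x2 -> rel y1 y2 -> rel (x1 * y1) (x2 * y2)) ->
    (forall i j, rel (A1 i j) (A2 i j)) ->
  rel (\det A1) (\det A2).
Proof.
move=> rel0 rel1 relN relD relM relA.
apply: (big_ind2 rel) => // s _; apply: (relM); last first.
  by apply: (big_ind2 rel) => // i _; apply: relA.
by case: (perm.odd_perm s); rewrite ?expr1 ?expr0 //; apply: relN.
Qed.

(** Pad A by a zero column and P by a zero row: the product is unchanged and
    becomes one of square matrices, the first of them singular. *)
Lemma det_mul_thin (R : comNzRingType) (n : nat)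
    (A : 'M[R]_(n.+1, n)) (P : 'M[R]_(n, n.+1)) : \det (A *m P) = 0.
Proof.
have -> : A *m P = row_mx (0 : 'cV_n.+1) A *m col_mx (0 : 'rV_n.+1) P.
  by rewrite mul_row_col mulmx0 add0r.
rewrite (det_mulmx (row_mx (0 : 'cV_n.+1) A : 'M_n.+1)) (expand_det_col _ ord0).
rewrite big1 ?mul0r // => i _.
by rewrite mxE; case: splitP => // j _; rewrite mxE mul0r.
Qed.

(** * The ideal of minors of a submodule of a free module *)

(** The right factor P is an arbitrary matrix rather than a choice of d
    columns; by the Cauchy-Binet formula this yields the same ideal, and the
    form A *m P is the one that is preserved when theta is applied.  The ideal
    is the intersection of those that contain the generators, so that a
    property of its elements follows as soon as it defines an ideal. *)
Definition minor_ideal (R : comNzRingType) (n : nat) (K : 'rV[R]_n -> Prop)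
    (d : nat) : set R :=
  fun x => forall I : set R, is_ideal I ->
    (forall (A : 'M[R]_(d, n)) (P : 'M[R]_(n, d)),
      (forall i, K (row i A)) -> I (\det (A *m P))) ->
    I x.

Section MinorIdeal.

Variables (R : comNzRingType) (n : nat) (K : 'rV[R]_n -> Prop).

Lemma minor_ideal_is_ideal (d : nat) : is_ideal (minor_ideal K d).
Proof.
split=> [I idI _|a b Ia Ib I idI I_det|r a Ia I idI I_det]; case: (idI) => //.
  by move=> _ ID _; apply: ID; [apply: Ia | apply: Ib].
by move=> _ _ IM; apply: IM; apply: Ia.
Qed.

Lemma det_minor_ideal (d : nat) (A : 'M[R]_(d, n)) (P : 'M[R]_(n, d)) :
  (forall i, K (row i A)) -> minor_ideal K d (\det (A *m P)).
Proof. by move=> KA I _; apply. Qed.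

Lemma minor_ideal0 : minor_ideal K 0 = setT.
Proof.
apply/seteqP; split=> // x _; have [_ _ IM] := minor_ideal_is_ideal 0.
rewrite -[x]mulr1; apply: IM.
by rewrite -(det_mx00 (@mulmx R 0 n 0 0 0)); apply: det_minor_ideal => -[].
Qed.

Lemma minor_ideal_big : minor_ideal K n.+1 = [set 0].
Proof.
have [I0 _ _] := minor_ideal_is_ideal n.+1.
apply/seteqP; split=> x; last by move=> ->.
apply=> [|A P _]; last exact: det_mul_thin.
by split=> //= [a b -> ->|r a ->]; rewrite ?addr0 ?mulr0.
Qed.

Lemma ideal_sum (I : set R) (J : Type) (s : seq J) (Q : pred J) (F : J -> R) :
  is_ideal I -> (forall j, Q j -> I (F j)) -> I (\sum_(j <- s | Q j) F j).
Proof. by case=> I0 ID _ IF; apply: big_ind. Qed.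

Lemma ideal_coefM (I : set R) (p q : {poly R}) :
  is_ideal I -> (forall m, I q`_m) -> forall m, I (p * q)`_m.
Proof.
move=> idI Iq m; rewrite coefM; apply: ideal_sum => // a _.
by case: idI => _ _; apply.
Qed.

(** The entries are the products u_i(T) w_j(T) of power series truncated at
    order N.  Taking out the powers of T, first row by row and then column by
    column, writes the determinant as a combination of determinants of
    constant matrices A *m P, with the coefficients u_(i, f i) of the u_i as
    rows of A. *)
Lemma det_conv_minor_ideal (d N m : nat) (u : 'I_d -> nat -> 'rV[R]_n)
    (w : nat -> 'I_d -> 'cV[R]_n) :
    (forall i a, K (u i a)) ->
  minor_ideal K d (\det (\matrix_(i, j) \sum_(a < N)
    'X^a * \poly_(b < N) (u i a *m w b j) 0 0))`_m.
Proof.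
move=> Ku; have idI := minor_ideal_is_ideal d.
rewrite det_sum_rows coef_sum; apply: ideal_sum => // f _.
apply: ideal_coefM => // {}m; rewrite -det_tr.
have -> : (\matrix_(i, j) \poly_(b < N) (u i (f i) *m w b j) 0 0)^T =
    \matrix_(j, i) \sum_(b < N) 'X^b * ((u i (f i) *m w b j) 0 0)%:P.
  apply/matrixP => j i; rewrite !mxE poly_def; apply: eq_bigr => b _.
  by rewrite mulrC mul_polyC.
rewrite det_sum_rows coef_sum; apply: ideal_sum => // g _.
apply: ideal_coefM => // {}m.
pose A := \matrix_i u i (f i); pose P := \matrix_(l, j) w (g j) j l 0.
have -> : \matrix_(j, i) ((u i (f i) *m w (g j) j) 0 0)%:P =
    map_mx polyC (A *m P)^T.
  apply/matrixP => j i; rewrite !mxE; congr _%:P.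
  by apply: eq_bigr => l _; rewrite !mxE.
rewrite det_map_mx det_tr coefC; case: eqP => _; last by case: idI.
by apply: det_minor_ideal => i; rewrite rowK.
Qed.

(** The hypothesis is the coefficientwise form of theta(v w) = C(v) Q(w), where
    C maps K into K[[T]].  It turns theta(det (A P)) into the determinant of a
    product whose left factor has rows in K[[T]]. *)
Lemma minor_ideal_ID (theta : R -> pseries R) (d : nat)
    (C : nat -> 'rV[R]_n -> 'rV[R]_n) (Q : nat -> 'cV[R]_n -> 'cV[R]_n) :
    ps_ring_morphism theta ->
    (forall a v, K v -> K (C a v)) ->
    (forall v w m, theta ((v *m w) 0 0) m =
      \sum_(a < m.+1) (C a v *m Q (m - a)%N w) 0 0) ->
  ID_ideal theta (minor_ideal K d).
Proof.
move=> [theta1 thetaD theta_mul] KC thetaCQ.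
have idI := minor_ideal_is_ideal d; have [I0 ID IM] := idI.
split=> // x Ix.
have theta0 m : theta 0 m = 0 by apply: additive_series0.
have thetaN y m : theta (- y) m = - theta y m.
  by apply/eqP; rewrite -addr_eq0 -[X in X == _]thetaD addNr theta0.
apply: (Ix (fun y => forall i, minor_ideal K d (theta y i)))
  => [|A P KA m] {x Ix}.
  split=> [i|a b Ia Ib i|r a Ia i]; first by rewrite theta0.
    by rewrite thetaD; apply: ID.
  by rewrite theta_mul; apply: ideal_sum => // j _; apply: IM.
(* Modulo 'X^(m+1), the polynomial p is the power series theta(x). *)
pose rel x (p : {poly R}) := forall k, (k < m.+1)%N -> p`_k = theta x k.
pose D := \matrix_(i < d, j < d) \sum_(a < m.+1)
  'X^a * \poly_(b < m.+1) (C a (row i A) *m Q b (col j P)) 0 0.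
suff relD : rel (\det (A *m P)) (\det D).
  by rewrite -relD //; apply: (@det_conv_minor_ideal _ _ _
    (fun i a => C a (row i A)) (fun b j => Q b (col j P))) => i a; apply: KC.
apply: det_related => [k _|k _|x p rel_xp k lt_km
    |x p y q rel_xp rel_yq k lt_km|x p y q rel_xp rel_yq k lt_km|i j k lt_km].
- by rewrite coef0 theta0.
- by rewrite coef1 theta1.
- by rewrite coefN thetaN rel_xp.
- by rewrite coefD thetaD rel_xp ?rel_yq.
- rewrite coefM theta_mul; apply: eq_bigr => a _.
  rewrite rel_xp ?rel_yq //; first exact: leq_ltn_trans (leq_subr _ _) lt_km.
  exact: leq_trans (ltn_ord a) lt_km.
have -> : (A *m P) i j = (row i A *m col j P) 0 0.
  by rewrite !mxE; apply: eq_bigr => l _; rewrite !mxE.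
rewrite thetaCQ mxE coef_sum.
rewrite (big_ord_widen m.+1 (fun a => (C a _ *m Q (k - a)%N _) 0 0)) //.
rewrite [RHS]big_mkcond; apply: eq_bigr => a _; rewrite coefXnM coef_poly.
rewrite [(a < k.+1)%N]ltnS; case: leqP => //= _.
by rewrite (leq_ltn_trans (leq_subr _ _) lt_km).
Qed.

End MinorIdeal.

(** * Presentations of a module by generators *)

Section LinearCombination.

Variables (R : comNzRingType) (M : lmodType R) (n : nat) (e : 'I_n -> M).

Definition lincomb (v : 'rV[R]_n) : M := \sum_i v 0 i *: e i.

Lemma lincomb_is_linear : linear lincomb.
Proof.
move=> a u v; rewrite scaler_sumr -big_split; apply: eq_bigr => i _ /=.
by rewrite !mxE scalerDl scalerA.
Qed.

HB.instance Definition _ :=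
  GRing.isLinear.Build R 'rV[R]_n M *:%R lincomb lincomb_is_linear.

Lemma row'0_col_mx m k (u : 'rV[R]_m) (A : 'M[R]_(k, m)) :
  row' (0 : 'I_(1 + k)) (col_mx u A) = A.
Proof. apply/matrixP => i j; rewrite [LHS]mxE -rshift1; exact: col_mxEd. Qed.

Lemma col'0_row_mx m k (u : 'cV[R]_m) (A : 'M[R]_(m, k)) :
  col' (0 : 'I_(1 + k)) (row_mx u A) = A.
Proof. apply/matrixP => i j; rewrite [LHS]mxE -rshift1; exact: row_mxEr. Qed.

Lemma col_mx_0 m k (u : 'rV[R]_m) (A : 'M[R]_(k, m)) j :
  col_mx u A (0 : 'I_(1 + k)) j = u 0 j.
Proof.
have -> : 0 = lshift k (0 : 'I_1) by apply: val_inj.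
exact: col_mxEu.
Qed.

Lemma row_mx_0 m k (u : 'cV[R]_m) (A : 'M[R]_(m, k)) i :
  row_mx u A i (0 : 'I_(1 + k)) = u i 0.
Proof.
have -> : 0 = lshift k (0 : 'I_1) by apply: val_inj.
exact: row_mxEl.
Qed.

(** A vector of minors of size d+1 that agrees with det (A P) v modulo the
    rows of A. *)
Definition bordered_minor d (A : 'M[R]_(d, n)) (P : 'M[R]_(n, d))
    (v : 'rV[R]_n) : 'rV[R]_n :=
  \row_l \det (col_mx v A *m row_mx (delta_mx l 0 : 'cV_n) P : 'M_(1 + d)).

Lemma bordered_minor_is_linear d (A : 'M[R]_(d, n)) (P : 'M[R]_(n, d)) :
  linear (bordered_minor A P).
Proof.
move=> a u v; apply/rowP => l; rewrite !mxE -[X in _ = _ + X]mul1r.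
apply: (determinant_multilinear (i0 := 0)).
- have row0 w : row (0 : 'I_(1 + d)) (col_mx w A *m row_mx (delta_mx l 0) P) =
      w *m row_mx (delta_mx l 0 : 'cV_n) P.
    rewrite row_mul; congr (_ *m _); apply/rowP => j.
    by rewrite mxE col_mx_0.
  by rewrite !row0 scale1r mulmxDl scalemxAl.
- by rewrite !mul_col_mx !row'0_col_mx.
- by rewrite !mul_col_mx !row'0_col_mx.
Qed.

(** The cofactors c_i of the bordering column do not depend on l.  Laplace
    expansion along it therefore reads phi(v) = c_0 v + sum c_i A_i with
    c_0 = det (A P), and the rows A_i of A are relations. *)
Lemma lincomb_bordered_minor d (A : 'M[R]_(d, n)) (P : 'M[R]_(n, d)) v :
    (forall i, lincomb (row i A) = 0) ->
  lincomb (bordered_minor A P v) = \det (A *m P) *: lincomb v.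
Proof.
move=> KA.
pose c (i : 'I_(1 + d)) := (-1) ^+ (i + 0) * \det (row' i (col_mx v A *m P)).
have -> : bordered_minor A P v =
    \sum_(i < 1 + d) c i *: row i (col_mx v A : 'M_(1 + d, n)).
  apply/rowP => l; rewrite mxE (expand_det_col _ 0) summxE.
  apply: eq_bigr => i _; rewrite mulrC [RHS]mxE [row _ _ _ _]mxE.
  rewrite mul_mx_row /cofactor col'0_row_mx row_mx_0; congr (_ * _).
  rewrite mxE (bigD1 l) //= big1 ?addr0 => [|j /negPf j_l].
    by rewrite [delta_mx _ _ _ _]mxE !eqxx mulr1.
  by rewrite [delta_mx _ _ _ _]mxE j_l mulr0.
rewrite linear_sum big_ord_recl big1 => [|i _]; last first.
  by rewrite linearZ -rshift1 rowKd /= KA scaler0.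
rewrite addr0 linearZ /= /c expr0 mul1r mul_col_mx row'0_col_mx.
by congr (_ *: lincomb _); apply/rowP => l; rewrite mxE col_mx_0.
Qed.

(** The x that admit such a phi form an ideal, so it suffices to treat a
    generator, where phi consists of the bordered minors: they lie in the next
    minor ideal when v is itself a relation. *)
Lemma minor_ideal_homotopy d x :
    let K v := lincomb v = 0 in
    minor_ideal K d.+1 = [set 0] -> minor_ideal K d x ->
  exists phi : 'rV[R]_n -> 'rV[R]_n,
    [/\ linear phi, forall v, K v -> phi v = 0
      & forall v, lincomb (phi v) = x *: lincomb v].
Proof.
move=> K Id0 Ix.
apply: (Ix (fun x => exists phi, [/\ linear phi, forall v, K v -> phi v = 0
  & forall v, lincomb (phi v) = x *: lincomb v])) => [|A P KA].
  split=> [|x1 x2 [f1 [lin1 K1 E1]] [f2 [lin2 K2 E2]]|r y [f [lin Kf E]]].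
  - exists (fun => 0); split=> // [a u v|v]; first by rewrite scaler0 addr0.
    by rewrite linear0 scale0r.
  - exists (fun v => f1 v + f2 v); split=> [a u v|v Kv|v].
    + by rewrite lin1 lin2 scalerDr addrACA.
    + by rewrite K1 ?K2 ?addr0.
    + by rewrite linearD /= E1 E2 scalerDl.
  - exists (fun v => r *: f v); split=> [a u v|v Kv|v].
    + by rewrite lin scalerDr !scalerA mulrC.
    + by rewrite Kf ?scaler0.
    + by rewrite linearZ /= E scalerA.
exists (bordered_minor A P); split; first exact: bordered_minor_is_linear.
  move=> v Kv; apply/rowP => l; rewrite !mxE.
  suff : minor_ideal K d.+1
      (\det (col_mx v A *m row_mx (delta_mx l 0 : 'cV_n) P : 'M_d.+1)).
    by rewrite Id0.
  apply: det_minor_ideal => i.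
  case: (@unliftP d.+1 0 i) => [j|] ->.
    suff -> : row (lift (0 : 'I_(1 + d)) j) (col_mx v A) = row j A by [].
    by rewrite -rshift1; apply: rowKd.
  suff -> : row (0 : 'I_(1 + d)) (col_mx v A) = v by [].
  by apply/rowP => j; rewrite mxE col_mx_0.
by move=> v; apply: lincomb_bordered_minor.
Qed.

End LinearCombination.

(** phi factors through M and defines a section of the map from the free
    module, so that M inherits the lifting property. *)
Lemma retraction_projective (R : comNzRingType) (M : lmodType R) (n : nat)
    (e : 'I_n -> M) (phi : 'rV[R]_n -> 'rV[R]_n) :
    (forall m, exists v, m = lincomb e v) -> linear phi ->
    (forall v, lincomb e v = 0 -> phi v = 0) ->
    (forall v, lincomb e (phi v) = lincomb e v) ->
  projective M.
Proof.
move=> e_gen lin_phi phi0 phiE X Y g f g_surj.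
have [s sE] := choice e_gen.
have [x xE] := fin_all_exists (fun i => g_surj (f (e i))).
pose h p := lincomb x (phi (s p)).
have phi_eq u v : lincomb e u = lincomb e v -> phi u = phi v.
  move=> uv; have /phi0 : lincomb e ((-1) *: v + u) = 0.
    by rewrite linearP /= uv scaleN1r addNr.
  by rewrite lin_phi scaleN1r addrC => /eqP; rewrite subr_eq0 => /eqP.
have lin_h : linear h.
  move=> a p q; rewrite /h -linearP -lin_phi; congr (lincomb x _).
  by apply: phi_eq; rewrite -sE linearP /= -!sE.
pose linear_h : {linear M -> X} :=
  HB.pack h (GRing.isLinear.Build R M X *:%R h lin_h).
exists linear_h => p /=.
rewrite /h /lincomb linear_sum [in RHS](sE p) -phiE /lincomb linear_sum.
by apply: eq_bigr => i _; rewrite !linearZ /= xE.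
Qed.

(** * Lifting the iterative derivation to a free cover *)

(** With B(T) the matrix of theta_M on the generators, B(0) = 1, the series
    C(v) = theta(v) B(T) lifts theta_M to the free module, and
    Q(w) = B(T)^-1 theta(w) is the dual action on functionals. *)
Lemma lift_theta (S : comNzRingType) (theta : S -> pseries S)
    (M : lmodType S) (thetaM : M -> pseries M) (n : nat) (e : 'I_n -> M) :
    ps_ring_morphism theta ->
    (forall m, exists v, m = lincomb e v) ->
    (forall m n, thetaM (m + n) =1 ps_add (thetaM m) (thetaM n)) ->
    (forall r m, thetaM (r *: m) =1 ps_scale (theta r) (thetaM m)) ->
    (forall m, thetaM m 0%N = m) ->
  exists (C : nat -> 'rV[S]_n -> 'rV[S]_n) (Q : nat -> 'cV[S]_n -> 'cV[S]_n),
    (forall a v, lincomb e (C a v) = thetaM (lincomb e v) a) /\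
    (forall v w m, theta ((v *m w) 0 0) m =
      \sum_(a < m.+1) (C a v *m Q (m - a)%N w) 0 0).
Proof.
move=> [theta1 thetaD theta_mul] e_gen tMD tMZ tM0.
have theta0 m : theta 0 m = 0 by apply: additive_series0.
have tM00 m : thetaM 0 m = 0 by apply: additive_series0.
have theta_sum (F : 'I_n -> S) m :
    theta (\sum_i F i) m = \sum_i theta (F i) m.
  exact: (big_morph (theta^~ m) (fun a b => thetaD a b m) (theta0 m)).
have tM_sum (F : 'I_n -> M) m :
    thetaM (\sum_i F i) m = \sum_i thetaM (F i) m.
  exact: (big_morph (thetaM^~ m) (fun a b => tMD a b m) (tM00 m)).
have /choice[B BE] : forall a, exists B : 'M[S]_n,
    (a = 0%N -> B = 1%:M) /\ forall i, thetaM (e i) a = lincomb e (row i B).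
  case=> [|a].
    exists 1%:M; split=> // i; rewrite tM0 /lincomb (bigD1 i) //= big1.
      by rewrite addr0 !mxE eqxx scale1r.
    by move=> j /negPf ij; rewrite !mxE eq_sym ij scale0r.
  have [v vE] := fin_all_exists (fun i => e_gen (thetaM (e i) a.+1)).
  by exists (\matrix_i v i); split=> // i; rewrite rowK.
have B0 : B 0%N = 1%:M by apply: (BE 0%N).1.
pose T m k (a : nat) (A : 'M[S]_(m, k)) := map_mx (theta^~ a) A.
have /choice[q qE] : forall w, exists q : nat -> 'cV[S]_n,
    forall m, T _ _ m w = \sum_(a < m.+1) B a *m q (m - a)%N.
  by move=> w; apply: conv_solve.
exists (fun m v => \sum_(a < m.+1) T _ _ a v *m B (m - a)%N).
exists (fun m w => q w m).
split=> [m v|v w m].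
  rewrite linear_sum /= [in RHS]/lincomb tM_sum.
  under [RHS]eq_bigr => i _ do rewrite tMZ /ps_scale.
  rewrite [RHS]exchange_big; apply: eq_bigr => a _ /=.
  have -> : T _ _ a v *m B (m - a)%N =
      \sum_i theta (v 0 i) a *: row i (B (m - a)%N).
    by rewrite mulmx_sum_row; apply: eq_bigr => i _; rewrite mxE.
  by rewrite linear_sum; apply: eq_bigr => i _; rewrite linearZ /= (BE _).2.
under [RHS]eq_bigr => c _ do rewrite mulmx_suml summxE.
rewrite (sum_triangle m (fun a b c => (T _ _ a v *m B b *m q w c) 0 0)).
rewrite mxE theta_sum; under eq_bigr => l _ do rewrite theta_mul /ps_mul.
rewrite exchange_big; apply: eq_bigr => a _ /=.
transitivity ((T _ _ a v *m T _ _ (m - a)%N w) 0 0).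
  by rewrite mxE; apply: eq_bigr => l _; rewrite !mxE.
rewrite qE mulmx_sumr summxE; apply: eq_bigr => b _.
by rewrite mulmxA.
Qed.

(** * Projectivity *)

Theorem theorem4p3 (S : comNzRingType) (theta : S -> pseries S)
    (theta_ID : iterative_derivation theta) (S_simple : ID_simple theta)
    (M : lmodType S) (thetaM : M -> pseries M)
    (M_ID : ID_module theta thetaM) :
  projective M.
Proof.
have [thetaR _] := theta_ID.
have [[n [e e_gen']] tMD tMZ [tM0 _]] := M_ID.
have e_gen m : exists v, m = lincomb e v.
  have [c ->] := e_gen' m; exists (\row_i c i).
  by apply: eq_bigr => i _; rewrite mxE.
pose K v := lincomb e v = 0.
have [C [Q [CE CQ]]] := lift_theta thetaR e_gen tMD tMZ tM0.
have KC a v : K v -> K (C a v).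
  by rewrite /K CE => ->; apply: additive_series0.
have dichotomy d : minor_ideal K d = [set 0] \/ minor_ideal K d = setT.
  by apply/S_simple/minor_ideal_ID; eauto.
have [d [IdT Id0]] :
    exists d, minor_ideal K d = setT /\ minor_ideal K d.+1 = [set 0].
  have [//|] : (exists d, minor_ideal K d = setT /\
      minor_ideal K d.+1 = [set 0]) \/ minor_ideal K n.+1 = setT.
    elim: n.+1 => [|k [|IkT]]; first by right; apply: minor_ideal0.
      by left.
    by have [Ik0|] := dichotomy k.+1; [left; exists k | right].
  rewrite minor_ideal_big => /seteqP[_ /(_ 1 I)] /eqP.
  by rewrite oner_eq0.
have [phi [lin_phi phi0 phiE]] :
    exists phi : 'rV[S]_n -> 'rV[S]_n, [/\ linear phi,
      forall v, K v -> phi v = 0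
    & forall v, lincomb e (phi v) = 1 *: lincomb e v].
  by apply: minor_ideal_homotopy Id0 _; rewrite IdT.
apply: (retraction_projective e_gen lin_phi phi0) => v.
by rewrite phiE scale1r.
Qed.
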